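(* Let $f:(0,\infty)\times[0,1]\to(0,\infty)$, $(x,q)\mapsto f(x;q)$, be a continuous function such that (i) $f(x+1;q)=[x]_q f(x;q)$ for all $x>0$, $q\in[0,1]$; (ii) $f(1;q)=1$ for all $q\in[0,1]$; (iii) the partial derivatives of $f$ with respect to $x$ up to order $2$ exist and are continuous on $(0,\infty)\times[0,1]$. Suppose that for some integer $m\ge 2$ there are positive constants $\alpha_m(q)$ (independent of $x$) such that for all $x>0$ and $q\in[0,1]$ $$f(x;q^m)\,f\!\left(x+\tfrac1m;q^m\right)\cdots f\!\left(x+\tfrac{m-1}{m};q^m\right)=\alpha_m(q)\,[m]_q^{1-mx}f(mx;q).\qquad( * )$$ Then $f(x;q)=\Gamma_q(x)$ for all $x>0$ and $q\in[0,1]$, and hence $f$ satisfies $( * )$ for all integers $m\ge 2$ with $$\alpha_m(q)=\prod_{i=1}^{m-1}\Gamma_{q^m}\!\left(\tfrac{i}{m}\right).$$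
   Context: For $0\le q<1$ and $x>0$, $[x]_q=\frac{1-q^x}{1-q}$ (so $[x]_0=1$), and $[x]_1=x$. For $0<q<1$ and $x>0$, $\Gamma_q(x)=\frac{(q;q)_\infty}{(q^x;q)_\infty}(1-q)^{1-x}$ with $(a;q)_\infty=\prod_{k=0}^\infty(1-aq^k)$; moreover $\Gamma_0(x)=1$ and $\Gamma_1(x)=\Gamma(x)$, the classical gamma function. *)

(* Defs.v *)
From HB Require Import structures.
From mathcomp Require Import all_boot all_order all_algebra.
From mathcomp Require Import all_classical all_reals all_analysis.

Set Implicit Arguments.
Unset Strict Implicit.
Unset Printing Implicit Defensive.

Import Order.TTheory GRing.Theory Num.Theory.
Import numFieldNormedType.Exports.

Local Open Scope classical_set_scope.
Local Open Scope ring_scope.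

(* [x]_q, meaningful for x > 0 and q in [0, 1]. *)
(* For x > 0 we have 0 `^ x = 0, so that [x]_0 = 1. *)
Definition qnumber (R : realType) (q x : R) : R :=
  if q == 1 then x else (1 - q `^ x) / (1 - q).

(* (a; q)_oo *)
Definition qpochhammer (R : realType) (a q : R) : R :=
  limn (fun n : nat => \prod_(0 <= k < n) (1 - a * q ^+ k)).

(* Euler's integral, meaningful for x > 0. *)
Definition Gamma (R : realType) (x : R) : R :=
  \int[lebesgue_measure]_(t in `]0, +oo[) (t `^ (x - 1) * expR (- t)).

(* Gamma_q(x), meaningful for x > 0 and q in [0, 1]. *)
Definition qGamma (R : realType) (q x : R) : R :=
  if q == 0 then 1
  else if q == 1 then Gamma x
  else qpochhammer q q / qpochhammer (q `^ x) q * (1 - q) `^ (1 - x).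

(* f x q stands for f(x; q); only its values on this set are meaningful. *)
Definition dom (R : realType) : set (R * R) := `]0, +oo[ `*` `[0, 1].
Arguments dom : clear implicits.

(* For i <= n, the i-th partial derivative in x exists on dom R and is     *)
(* continuous there.  As the x-range is open, ordinary derivatives at      *)
(* x > 0 do not depend on the values of f outside dom R.                   *)
Definition C_in_x (R : realType) (n : nat) (f : R -> R -> R) : Prop :=
  (forall (i : nat) (x q : R), (i < n)%N -> dom R (x, q) ->
     derivable (derive1n i (f ^~ q)) x 1) /\
  (forall i : nat, (i <= n)%N ->
     {within dom R, continuous (fun p : R * R => derive1n i (f ^~ p.2) p.1)}).

Definition multiplication_formula (R : realType) (f : R -> R -> R)
    (m : nat) (alpha : R -> R) : Prop :=
  forall x q : R, dom R (x, q) ->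
    \prod_(0 <= i < m) f (x + i%:R / m%:R) (q ^+ m) =
    alpha q * qnumber q m%:R `^ (1 - m%:R * x) * f (m%:R * x) q.

(* Main.v *)
Require Import Defs.
From HB Require Import structures.
From mathcomp Require Import all_boot all_order all_algebra.
From mathcomp Require Import all_classical all_reals all_analysis.
From mathcomp Require Import measurable_realfun ring lra.

(* For fixed q, let D(x, h; q) be the second difference of ln f(.; q) at x with
   step h.  The factor alpha_m(q) [m]_q^{1 - mx} is log-affine, so the
   multiplication formula gives
     D(x, h; q) = \sum_(i < m) D((x + i)/m, h/m; q^m),
   and log-concavity of x |-> [x]_q gives D(x + 1, h; q) <= D(x, h; q).  The C^2
   hypothesis bounds D below by - C h^2 on a compact range of x away from 0,
   uniformly in q; the shift inequality carries this bound to 0 < h < x <= K, and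
   each use of the multiplication formula divides C by m.  Hence D >= 0, i.e.
   f(.; q) is log-convex for every q in [0, 1], including q = 1.

   A Bohr-Mollerup argument, uniform in q because n q^n <= [n]_q, then shows
   that f(.; q) is determined by log-convexity, the shift equation and f(1; q) = 1.
   Comparing with Euler's integral settles q = 1, and the same squeeze gives the
   infinite product for q < 1.  Applied to
     x |-> [m]_q^{x - 1} \prod_(i < m) f((x + i)/m; q^m) / \prod_(1 <= i < m) f(i/m; q^m)
   uniqueness also yields the multiplication formula for every m. *)

Set Implicit Arguments.
Unset Strict Implicit.
Unset Printing Implicit Defensive.

Import Order.TTheory GRing.Theory Num.Theory.
Import numFieldNormedType.Exports.

Local Open Scope classical_set_scope.
Local Open Scope ring_scope.

(** * q-numbers and a q-Bohr-Mollerup theorem *)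

Section qnumber.
Context {R : realType}.
Implicit Types (q x y s : R) (F G : R -> R).

Lemma powR_lt1 q x : 0 <= q < 1 -> 0 < x -> q `^ x < 1.
Proof.
move=> /andP[q0 q1] x0; have := @gt0_ltr_powR R _ x0 q 1.
by rewrite powR1 !nnegrE => /(_ q0 ler01 q1).
Qed.

Lemma qnumber_gt0 q x : 0 <= q <= 1 -> 0 < x -> 0 < qnumber q x.
Proof.
move=> /andP[q0 q1] x0; rewrite /qnumber; case: eqVneq => // qn1.
have {qn1}q1 : q < 1 by rewrite lt_neqAle qn1.
by rewrite divr_gt0 ?subr_gt0// powR_lt1 ?q0.
Qed.

Lemma le_qnumber q x y : 0 <= q <= 1 -> 0 < x -> x <= y ->
  qnumber q x <= qnumber q y.
Proof.
move=> /andP[q0 q1] x0 xy; rewrite /qnumber; case: eqVneq => // qn1.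
have {qn1}q1 : q < 1 by rewrite lt_neqAle qn1.
rewrite ler_pM2r ?invr_gt0 ?subr_gt0// lerB//.
move: q0; rewrite le_eqVlt => /predU1P[<-|q0].
  by rewrite !powR0 ?gt_eqF// (lt_le_trans x0).
by apply: ger_powR => //; rewrite q0 ltW.
Qed.

Lemma qnumberS q n : 0 <= q <= 1 ->
  qnumber q n.+1%:R = qnumber q n%:R + q ^+ n.
Proof.
move=> /andP[q0 q1]; rewrite /qnumber; case: eqVneq => [->|qn1].
  by rewrite expr1n natr1.
rewrite !powR_mulrn// exprS; field.
by rewrite subr_eq0 eq_sym.
Qed.

(** [n]_q is the sum of the n powers q^k with k < n, each of them at least q^n. *)
Lemma ge_nat_qnumber q n : 0 <= q <= 1 -> n%:R * q ^+ n <= qnumber q n%:R.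
Proof.
move=> q01; have /andP[q0 q1] := q01; elim: n => [|n IH].
  rewrite mul0r /qnumber; case: ifP => // _.
  by rewrite powRr0 subrr mul0r.
rewrite qnumberS// -natr1 mulrDl mul1r exprS lerD//.
  by apply: le_trans IH; rewrite ler_wpM2l// ler_piMl// exprn_ge0.
by rewrite ler_piMl// exprn_ge0.
Qed.

(** The increment q^n is at most [n]_q / n. The factor 1 + 1/n is free of q and becomes the whole
    error of the squeeze in [qgamma_le01]. *)
Lemma qnumberS_le q n : 0 <= q <= 1 -> (0 < n)%N ->
  qnumber q n.+1%:R <= (1 + n%:R^-1) * qnumber q n%:R.
Proof.
move=> q01 n0; rewrite qnumberS// mulrDl mul1r lerD2l mulrC ler_pdivlMr ?ltr0n//.
by rewrite mulrC ge_nat_qnumber.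
Qed.

(** With a = q^x and b = q^y, the difference of the two sides is (a / b) (b - 1)^2 up to the factor
    (1 - q)^-2; for q = 1 it is y^2. *)
Lemma qnumber_log_concave q x y : 0 <= q <= 1 -> 0 < y < x ->
  qnumber q (x + y) * qnumber q (x - y) <= qnumber q x ^+ 2.
Proof.
move=> /andP[q0 q1] /andP[y0 yx]; rewrite /qnumber; case: eqVneq => [_|qn1].
  by rewrite mulrC -subr_sqr gerBl sqr_ge0.
have {qn1}q1 : q < 1 by rewrite lt_neqAle qn1.
rewrite mulrACA expr_div_n (_ : _^-1 * _ = (1 - q) ^- 2); last first.
  by rewrite -exprVn expr2.
rewrite ler_pM2r ?invr_gt0 ?exprn_gt0 ?subr_gt0//.
move: q0; rewrite le_eqVlt => /predU1P[<-|q0].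
  by rewrite !powR0 ?subr0 ?mul1r ?expr1n// gt_eqF//; lra.
rewrite powRD ?powRB ?(gt_eqF q0) ?implybT//.
have := powR_gt0 x q0; have := powR_gt0 y q0.
move: (q `^ x) (q `^ y) => a b b0 a0.
rewrite -subr_ge0 (_ : _ - _ = a * b^-1 * (b - 1) ^+ 2).
  by rewrite mulr_ge0 ?sqr_ge0// mulr_ge0 ?invr_ge0 ?ltW.
by field; rewrite gt_eqF.
Qed.

Lemma qnumber_mull q x (m : nat) : 0 <= q <= 1 -> (0 < m)%N -> 0 < x ->
  qnumber q (m%:R * x) = qnumber q m%:R * qnumber (q ^+ m) x.
Proof.
move=> /andP[q0 q1] m0 x0; rewrite /qnumber.
case: (eqVneq q) => [->|qn1]; first by rewrite expr1n eqxx.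
have {qn1}q1 : q < 1 by rewrite lt_neqAle qn1.
have qm1 : q ^+ m < 1 by rewrite exprn_ilt1// -lt0n.
rewrite (lt_eqF qm1) powRrM powR_mulrn//; field.
by rewrite !subr_eq0 !gt_eqF.
Qed.

(* The last clause is the only consequence of log-convexity that uniqueness
   needs; for Euler's integral it is easier to prove than log-convexity. *)
Record is_qgamma q F : Prop := IsQGamma {
  qgamma_gt0 : forall x, 0 < x -> 0 < F x;
  qgamma1 : F 1 = 1;
  qgammaS : forall x, 0 < x -> F (x + 1) = qnumber q x * F x;
  qgammaD_le : forall x s, 0 < x -> 0 <= s <= 1 ->
    F (x + s) <= qnumber q x `^ s * F x }.

Lemma eq_qnumber_shift q F G : 0 <= q <= 1 ->
  (forall x, 0 < x -> F (x + 1) = qnumber q x * F x) ->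
  (forall x, 0 < x -> G (x + 1) = qnumber q x * G x) ->
  (forall x, 0 < x <= 1 -> F x = G x) -> forall x, 0 < x -> F x = G x.
Proof.
move=> q01 FS GS FG x x0.
have [n xn] : exists n : nat, x <= n%:R.
  by exists (Num.truncn x).+1; exact/ltW/truncnS_gt.
elim: n x x0 xn => [|n IH] x x0 xn; first by move: (lt_le_trans x0 xn); rewrite ltxx.
have [x1|x1] := leP x 1; first by rewrite FG// x0.
have x10 : 0 < x - 1 by rewrite subr_gt0.
by rewrite -(subrK 1 x) FS// GS// IH// lerBlDr natr1.
Qed.

(** Both functions pick up the same factor [x]_q under a unit shift, so F / G has period 1 and can
    be compared far out, at x + n. *)
Lemma qgamma_shift_ratio q F G (n : nat) x : 0 <= q <= 1 ->
  is_qgamma q F -> is_qgamma q G -> 0 < x ->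
  F (x + n%:R) / G (x + n%:R) = F x / G x.
Proof.
move=> q01 HF HG x0; elim: n => [|n IH]; first by rewrite addr0.
have xn0 : 0 < x + n%:R by rewrite ltr_wpDr.
rewrite -natr1 addrA (qgammaS HF)// (qgammaS HG)// -mulf_div divff ?mul1r//.
by rewrite gt_eqF// qnumber_gt0.
Qed.

Lemma qgamma_nat q F G (n : nat) : 0 <= q <= 1 ->
  is_qgamma q F -> is_qgamma q G -> (0 < n)%N -> F n%:R = G n%:R.
Proof.
move=> q01 HF HG; case: n => // n _.
have := @qgamma_shift_ratio q F G n 1 q01 HF HG ltr01.
rewrite (qgamma1 HF) (qgamma1 HG) divff ?oner_eq0// nat1r => /divr1_eq.
exact.
Qed.

(** The Bohr-Mollerup squeeze. By periodicity F / G is estimated at x + n: a step of length x from n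
    bounds F(x + n) above, and a step of length 1 - x from x + n to n + 1 bounds G(x + n) below.
    Since F and G agree at n, the quotient is at most 1 + 1/n. *)
Lemma qgamma_le01 q F G x : 0 <= q <= 1 ->
  is_qgamma q F -> is_qgamma q G -> 0 < x <= 1 -> F x <= G x.
Proof.
move=> q01 HF HG /andP[x0 x1].
have Gx0 := qgamma_gt0 HG x0.
suff H (n : nat) : (0 < n)%N -> F x / G x <= 1 + n%:R^-1.
  rewrite -[leRHS]mul1r -ler_pdivrMr//.
  apply/ler_addgt0Pr => e e0.
  apply: le_trans (H (Num.truncn e^-1).+1 isT) _.
  by rewrite lerD2l invf_ple ?posrE// ltW// truncnS_gt.
move=> n0; have n0' : 0 < n%:R :> R by rewrite ltr0n.
have xn0 : 0 < x + n%:R by rewrite addr_gt0.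
have [a0 b0 c0] : [/\ 0 < qnumber q n%:R, 0 < qnumber q (x + n%:R) & 0 < G n%:R].
  by rewrite !qnumber_gt0// (qgamma_gt0 HG).
have Gxn0 := qgamma_gt0 HG xn0.
rewrite -(qgamma_shift_ratio n q01 HF HG)// ler_pdivrMr//.
have FU : F (x + n%:R) <= qnumber q n%:R `^ x * G n%:R.
  rewrite -(qgamma_nat q01 HF HG)// addrC; apply: (qgammaD_le HF) => //.
  by rewrite ltW.
have GL : qnumber q n%:R * G n%:R <= qnumber q (x + n%:R) `^ (1 - x) * G (x + n%:R).
  rewrite -(qgammaS HG)// (_ : n%:R + 1 = x + n%:R + (1 - x)); last by ring.
  apply: (qgammaD_le HG) => //; lra.
apply: (le_trans FU); rewrite -(ler_pM2l a0) mulrCA.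
apply: (le_trans (ler_wpM2l (powR_ge0 _ _) GL)).
rewrite !mulrA ler_wpM2r ?(ltW Gxn0)//.
have cb : qnumber q (x + n%:R) <= (1 + n%:R^-1) * qnumber q n%:R.
  apply: le_trans (qnumberS_le q01 n0).
  by rewrite le_qnumber// -nat1r lerD2r.
have k1 : 1 <= 1 + n%:R^-1 :> R by rewrite lerDl invr_ge0.
have k0 : 0 <= 1 + n%:R^-1 :> R by rewrite (le_trans ler01).
(* As 1 - x <= 1, raising 1 + 1/n >= 1 to this power does not increase it. *)
have h : qnumber q (x + n%:R) `^ (1 - x) <=
    (1 + n%:R^-1) * qnumber q n%:R `^ (1 - x).
  have x10 : 0 <= 1 - x by rewrite subr_ge0.
  apply: (@le_trans _ _ (((1 + n%:R^-1) * qnumber q n%:R) `^ (1 - x))).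
    by apply: ge0_ler_powR => //; rewrite nnegrE ?mulr_ge0// ltW.
  rewrite powRM ?(ltW a0)// ler_wpM2r ?powR_ge0// ler1_powR//.
  by rewrite gerBl ltW.
apply: (le_trans (ler_wpM2l (powR_ge0 _ _) h)).
rewrite mulrCA -powRD; last by rewrite (gt_eqF a0) implybT.
by rewrite (_ : x + (1 - x) = 1) ?powRr1 ?(ltW a0) 1?mulrC//; ring.
Qed.

Lemma qgamma_unique q F G x : 0 <= q <= 1 ->
  is_qgamma q F -> is_qgamma q G -> 0 < x -> F x = G x.
Proof.
move=> q01 HF HG; apply: (@eq_qnumber_shift q) => //; [exact: qgammaS|exact: qgammaS|].
by move=> y y01; apply/le_anti;
  rewrite (qgamma_le01 q01 HF HG y01) (qgamma_le01 q01 HG HF y01).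
Qed.

End qnumber.

(** * Midpoint convexity and mean value bounds *)

Section convexity.
Context {R : realType}.
Implicit Types (a b t : R) (g u : R -> R).

(** Subtract the chord and take a maximum point c of the difference k. If k(c) > 0, step from c by
    its distance to the nearer endpoint: k vanishes there and is at most k(c) on the other side, so
    2 k(c) <= k(c), a contradiction. *)
Lemma midpoint_convex g a b t : a <= b -> {within `[a, b], continuous g} ->
  (forall x h, 0 < h -> a <= x - h -> x + h <= b ->
     2 * g x <= g (x + h) + g (x - h)) ->
  0 <= t <= 1 -> g ((1 - t) * a + t * b) <= (1 - t) * g a + t * g b.
Proof.
rewrite le_eqVlt => /predU1P[<- _ _ _|ab cg mg /andP[t0 t1]].
  by rewrite -!mulrDl subrK !mul1r.
have ba0 : b - a != 0 by rewrite subr_eq0 gt_eqF.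
pose l := (g b - g a) / (b - a).
pose k x := g x - (g a + l * (x - a)).
have ck : {within `[a, b], continuous k}.
  move=> x; apply: cvgB; first exact: cg.
  suff /continuous_subspaceT : continuous (fun x : R => g a + l * (x - a)) by exact.
  move=> z; apply: cvgD; first exact: cvg_cst.
  apply: cvgM; first exact: cvg_cst.
  by apply: cvgB; [exact: cvg_id|exact: cvg_cst].
have ka : k a = 0 by rewrite /k subrr mulr0 addr0 subrr.
have kb : k b = 0 by rewrite /k /l; field.
have mk x h : 0 < h -> a <= x - h -> x + h <= b -> 2 * k x <= k (x + h) + k (x - h).
  move=> h0 axh xhb; have := mg x h h0 axh xhb; rewrite /k; lra.
have [c] := EVT_max (ltW ab) ck.
rewrite in_itv/= => /andP[ac cb] kc.
have kc0 : k c <= 0.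
  rewrite leNgt; apply/negP => kc0.
  have nac : a < c by rewrite lt_neqAle ac andbT;
    apply: contraTneq kc0 => <-; rewrite ka ltxx.
  have ncb : c < b by rewrite lt_neqAle cb andbT;
    apply: contraTneq kc0 => ->; rewrite kb ltxx.
  have [h|/ltW h] := leP (c - a) (b - c).
  - have := mk c (c - a); rewrite subKr ka.
    have := kc (c + (c - a)); rewrite in_itv/=; lra.
  - have := mk c (b - c); rewrite (_ : c + (b - c) = b) ?kb; last by ring.
    have := kc (c - (b - c)); rewrite in_itv/=; lra.
have tab : (1 - t) * a + t * b \in `[a, b].
  have -> : (1 - t) * a + t * b = a + t * (b - a) by ring.
  rewrite in_itv/= lerDl mulr_ge0 ?subr_ge0 ?(ltW ab)//=.
  by rewrite -lerBrDl ler_piMl// subr_ge0 ltW.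
have := le_trans (kc _ tab) kc0; rewrite /k subr_le0 => /le_trans; apply.
rewrite le_eqVlt; apply/orP; left; apply/eqP; rewrite /l; field.
exact: ba0.
Qed.

Lemma bounded_diff u a b x y B : (forall z, a <= z <= b -> derivable u z 1) ->
  (forall z, a <= z <= b -> `|(derive1 u) z| <= B) ->
  a <= x -> y <= b -> x <= y -> `|u y - u x| <= B * (y - x).
Proof.
move=> du Bu ax yb xy.
have [z zxy||c cxy ->] := @MVT_segment _ u (derive1 u) x y xy.
- rewrite derive1E; apply: DeriveDef => //; apply: du.
  by move: zxy; rewrite in_itv/=; lra.
- apply: derivable_within_continuous => z; rewrite in_itv/= => zxy.
  by apply: du; lra.
- rewrite normrM (ger0_norm (_ : 0 <= y - x)) ?subr_ge0// ler_wpM2r ?subr_ge0//.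
  by apply: Bu; move: cxy; rewrite in_itv/=; lra.
Qed.

(** The mean value theorem on each side of x gives (u'(c) - u'(d)) h with c - d <= 2 h, and a third
    use, on u', gives the bound. *)
Lemma bounded_diff2 u a b x h B :
  (forall z, a <= z <= b -> derivable u z 1) ->
  (forall z, a <= z <= b -> derivable (derive1 u) z 1) ->
  (forall z, a <= z <= b -> `|(derive1 (derive1 u)) z| <= B) ->
  0 <= h -> a <= x - h -> x + h <= b ->
  `|u (x + h) + u (x - h) - 2 * u x| <= 2 * B * h ^+ 2.
Proof.
move=> du ddu Bu h0 axh xhb.
have mvt y z : a <= y -> y <= z -> z <= b ->
    exists2 c, y <= c <= z & u z - u y = (derive1 u) c * (z - y).
  move=> ay yz zb.
  have [c cyz||c cyz ->] := @MVT_segment _ u (derive1 u) y z yz.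
  - rewrite derive1E; apply: DeriveDef => //; apply: du.
    by move: cyz; rewrite in_itv/=; lra.
  - apply: derivable_within_continuous => c; rewrite in_itv/= => cyz.
    by apply: du; lra.
  - by exists c => //; move: cyz; rewrite in_itv.
have [||| c /andP[xc cxh] e1] := mvt x (x + h); try lra.
have [||| d /andP[xd dxh] e2] := mvt (x - h) x; try lra.
have -> : u (x + h) + u (x - h) - 2 * u x = ((derive1 u) c - (derive1 u) d) * h.
  by rewrite mulrBl; move: e1 e2; lra.
have B0 : 0 <= B by apply: le_trans (normr_ge0 _) (Bu x _); lra.
rewrite normrM (ger0_norm h0) expr2 mulrA ler_wpM2r//.
apply: (@le_trans _ _ (B * (c - d))).
  by apply: (@bounded_diff _ a b) => //; lra.
by rewrite (mulrC 2) -mulrA ler_wpM2l//; lra.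
Qed.

End convexity.

(** * Bounds uniform in q on compact rectangles *)

Section dom_compact.
Context {R : realType}.

Lemma dom_bounded (u : R * R -> R) (a b : R) : 0 < a ->
  {within dom R, continuous u} ->
  exists2 B, 0 <= B & forall x q, a <= x <= b -> 0 <= q <= 1 -> `|u (x, q)| <= B.
Proof.
move=> a0 cu.
have cK : compact (`[a, b] `*` `[0 : R, 1]).
  by apply: compact_setX; exact: segment_compact.
have sub : `[a, b] `*` `[0 : R, 1] `<=` dom R.
  move=> [x q] [/=]; rewrite !in_itv/= => /andP[ax xb] q01; split => //=.
  by rewrite in_itv/= andbT (lt_le_trans a0).
have /compact_bounded[M [_ MB]] :=
  continuous_compact (continuous_subspaceW sub cu) cK.
exists (`|M| + 1); first by rewrite addr_ge0.
move=> x q xab q01; apply: MB; first by rewrite ltr_pwDr// ler_norm.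
by exists (x, q) => //; split; rewrite /= in_itv.
Qed.

Lemma dom_bounded_below (u : R * R -> R) (a b : R) : 0 < a ->
  {within dom R, continuous u} -> (forall p, dom R p -> 0 < u p) ->
  exists2 c, 0 < c & forall x q, a <= x <= b -> 0 <= q <= 1 -> c <= u (x, q).
Proof.
move=> a0 cu u0.
have [ab|ba] := leP a b; last first.
  by exists 1 => // x q /andP[ax /(le_trans ax)]; rewrite leNgt ba.
have cK : compact (`[a, b] `*` `[0 : R, 1]).
  by apply: compact_setX; exact: segment_compact.
have sub : `[a, b] `*` `[0 : R, 1] `<=` dom R.
  move=> [x q] [/=]; rewrite !in_itv/= => /andP[ax xb] q01; split => //=.
  by rewrite in_itv/= andbT (lt_le_trans a0).
have K0 : `[a, b] `*` `[0 : R, 1] !=set0.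
  by exists (a, 0); split; rewrite /= in_itv/= lexx ?ab ?ler01.
have [p] := compact_EVT_min K0 cK (continuous_subspaceW sub cu).
rewrite inE => Kp minp; exists (u p); first by apply: u0; exact: sub.
by move=> x q xab q01; apply: minp; rewrite inE; split; rewrite /= in_itv.
Qed.

End dom_compact.

(** * Log-convexity from a multiplication formula *)

Section logconvex.
Context {R : realType}.
Implicit Types (q x h : R) (F G : R -> R).

Definition logconvex F := forall x y t : R, 0 < x -> 0 < y -> 0 <= t <= 1 ->
  F ((1 - t) * x + t * y) <= F x `^ (1 - t) * F y `^ t.

(** The second central difference of ln F: the D(x, h; q) of the overview when F is f(.; q). *)
Definition logdiff F x h := ln (F (x + h)) + ln (F (x - h)) - 2 * ln (F x).

(** Write x + s as (1 - s) x + s (x + 1) and use F(x + 1)^s = [x]_q^s F(x)^s. *)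
Lemma logconvex_is_qgamma q F : 0 <= q <= 1 -> (forall x, 0 < x -> 0 < F x) ->
  F 1 = 1 -> (forall x, 0 < x -> F (x + 1) = qnumber q x * F x) ->
  logconvex F -> is_qgamma q F.
Proof.
move=> q01 F0 F1 FS cF; split => // x s x0 s01.
have Fx0 := F0 _ x0; have qx0 := qnumber_gt0 q01 x0.
have := cF x (x + 1) s x0 (addr_gt0 x0 ltr01) s01.
rewrite FS// powRM ?(ltW Fx0) ?(ltW qx0)// mulrCA.
rewrite -powRD; last by rewrite (gt_eqF Fx0) implybT.
by rewrite subrK powRr1 ?(ltW Fx0)// (_ : (1 - s) * x + _ = x + s)//; ring.
Qed.

Lemma logconvex_comp F (a b : R) : 0 < a -> 0 <= b -> logconvex F ->
  logconvex (fun x => F (a * x + b)).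
Proof.
move=> a0 b0 cF x y t x0 y0 t01.
rewrite (_ : a * _ + b = (1 - t) * (a * x + b) + t * (a * y + b)); last by ring.
by apply: cF => //; rewrite ltr_wpDr// mulr_gt0.
Qed.

Lemma logconvexM F G : (forall x, 0 < x -> 0 < F x) ->
  (forall x, 0 < x -> 0 < G x) ->
  logconvex F -> logconvex G -> logconvex (F \* G).
Proof.
move=> F0 G0 cF cG x y t x0 y0 t01 /=; have /andP[t0 t1] := t01.
have [Fx Fy Gx Gy] : [/\ 0 <= F x, 0 <= F y, 0 <= G x & 0 <= G y].
  by split; apply/ltW; rewrite ?F0 ?G0.
have z0 : 0 < (1 - t) * x + t * y.
  by move: t0; rewrite le_eqVlt => /predU1P[<-|t0]; nra.
by rewrite !powRM// mulrACA ler_pM ?cF ?cG//; exact/ltW/G0 || exact/ltW/F0.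
Qed.

(** The shift adds the second difference of ln [x]_q, which is nonpositive by
    [qnumber_log_concave]. *)
Lemma logdiff_shift q F x h : 0 <= q <= 1 -> (forall x, 0 < x -> 0 < F x) ->
  (forall x, 0 < x -> F (x + 1) = qnumber q x * F x) -> 0 < h < x ->
  logdiff F (x + 1) h <= logdiff F x h.
Proof.
move=> q01 F0 FS /andP[h0 hx]; have x0 := lt_trans h0 hx.
have xh0 : 0 < x - h by rewrite subr_gt0.
have xh1 : 0 < x + h by rewrite addr_gt0.
have lnS y : 0 < y -> ln (F (y + 1)) = ln (qnumber q y) + ln (F y).
  by move=> y0; rewrite FS// lnM// posrE ?qnumber_gt0// F0.
rewrite /logdiff (addrAC x) (addrAC x 1) !lnS//.
have : ln (qnumber q (x + h)) + ln (qnumber q (x - h)) <= 2 * ln (qnumber q x).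
  rewrite -lnM ?posrE ?qnumber_gt0// mulr_natl -lnXn ?qnumber_gt0//.
  rewrite ler_ln ?posrE ?exprn_gt0 ?mulr_gt0 ?qnumber_gt0//.
  by apply: qnumber_log_concave => //; rewrite h0.
lra.
Qed.

Lemma ln_prod (I : Type) (r : seq I) (u : I -> R) : (forall i, 0 < u i) ->
  ln (\prod_(i <- r) u i) = \sum_(i <- r) ln (u i).
Proof.
move=> u0; elim: r => [|i r IH]; first by rewrite !big_nil ln1.
by rewrite !big_cons lnM ?IH// posrE ?prodr_gt0.
Qed.

(** Taken at y / m, the product formula expresses ln G(y) as a sum of ln F((y + i) / m) plus a
    function affine in y, which second differences annihilate. *)
Lemma logdiff_mult F G (c b : R) (m : nat) x h : (0 < m)%N ->
  0 < c -> 0 < b ->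
  (forall x, 0 < x -> 0 < F x) -> (forall x, 0 < x -> 0 < G x) ->
  (forall x, 0 < x ->
    \prod_(0 <= i < m) F (x + i%:R / m%:R) = c * b `^ (1 - m%:R * x) * G (m%:R * x)) ->
  0 < h < x ->
  logdiff G x h = \sum_(0 <= i < m) logdiff F ((x + i%:R) / m%:R) (h / m%:R).
Proof.
move=> m0 c0 b0 F0 G0 FG /andP[h0 hx].
have m0' : 0 < m%:R :> R by rewrite ltr0n.
have lnG y : 0 < y -> ln (G y) = (\sum_(0 <= i < m) ln (F ((y + i%:R) / m%:R))) -
    ln c - (1 - y) * ln b.
  move=> y0; have ym0 : 0 < y / m%:R by rewrite divr_gt0.
  have := FG _ ym0; rewrite (mulrC m%:R) divfK ?gt_eqF// => e.
  rewrite -ln_prod; last first.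
    by move=> i; apply: F0; rewrite divr_gt0// ltr_wpDr.
  under eq_bigr do rewrite mulrDl.
  rewrite e !lnM ?posrE ?mulr_gt0 ?powR_gt0 ?G0// ln_powR; ring.
have x0 := lt_trans h0 hx.
have xh0 : 0 < x - h by rewrite subr_gt0.
have xh1 : 0 < x + h by rewrite addr_gt0.
rewrite /logdiff !lnG//.
under [RHS]eq_bigr do rewrite -mulrDl -mulrBl (addrAC x _ h) (addrAC x _ (- h)).
rewrite sumrB big_split/= -mulr_sumr; ring.
Qed.

(** Reduces the bound to F(x)^2 - F(x + h) F(x - h), so that derivatives of F itself suffice and ln
    F need not be differentiated. *)
Lemma logdiff_ge F x h (c Q : R) : 0 < c ->
  0 <= Q -> c <= F (x + h) -> c <= F (x - h) -> 0 < F x ->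
  F x ^+ 2 - F (x + h) * F (x - h) <= Q -> - (Q / c ^+ 2) <= logdiff F x h.
Proof.
move=> c0 Q0 c1 c2 Fx0 FQ.
have F1 := lt_le_trans c0 c1; have F2 := lt_le_trans c0 c2.
rewrite /logdiff mulr_natl -lnXn// -lnM// -ln_div ?posrE ?mulr_gt0 ?exprn_gt0//.
rewrite lerNl -lnV ?posrE ?divr_gt0 ?mulr_gt0 ?exprn_gt0// invf_div.
set P := F (x + h) * F (x - h) in FQ *.
have P0 : 0 < P by rewrite mulr_gt0.
rewrite (_ : F x ^+ 2 / P = 1 + (F x ^+ 2 - P) / P); last first.
  by field; rewrite gt_eqF.
(* ln z <= z - 1 at z = F(x)^2 / P, so that no smallness of h is needed *)
apply: le_trans (le_ln1Dx _) _.
  by rewrite mulrBl divff ?gt_eqF// ltrBrDr addrC subrr divr_gt0// exprn_gt0.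
apply: (@le_trans _ _ (Q / P)).
  by rewrite ler_wpM2r// invr_ge0 ltW.
rewrite ler_wpM2l// lef_pV2 ?posrE ?exprn_gt0//.
by rewrite expr2 ler_pM// ltW.
Qed.

(** Nonnegative second differences are midpoint convexity of ln F; derivability supplies the
    continuity that [midpoint_convex] asks for. *)
Lemma logdiff_ge0_logconvex F : (forall x, 0 < x -> 0 < F x) ->
  (forall x, 0 < x -> derivable F x 1) ->
  (forall x h, 0 < h < x -> 0 <= logdiff F x h) -> logconvex F.
Proof.
move=> F0 dF FD.
have H (x y t : R) : 0 < x -> x <= y -> 0 <= t <= 1 ->
    F ((1 - t) * x + t * y) <= F x `^ (1 - t) * F y `^ t.
  move=> x0 xy t01; have y0 := lt_le_trans x0 xy.
  have Fx0 := F0 _ x0; have Fy0 := F0 _ y0.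
  have /andP[t0 t1] := t01.
  have z0 : 0 < (1 - t) * x + t * y.
    by move: t0; rewrite le_eqVlt => /predU1P[<-|t0]; nra.
  have : ln (F ((1 - t) * x + t * y)) <= (1 - t) * ln (F x) + t * ln (F y).
    apply: (@midpoint_convex _ (@ln R \o F) x y t xy _ _ t01) => /=.
      apply/continuous_in_subspaceT => z; rewrite inE/= in_itv/= => /andP[xz _].
      have z0' := lt_le_trans x0 xz.
      apply: continuous_comp; last by apply: continuous_ln; exact: F0.
      by apply: differentiable_continuous; apply/derivable1_diffP; exact: dF.
    move=> z h h0 xzh zhy; have := FD z h; rewrite /logdiff; lra.
  rewrite -!ln_powR -lnM ?posrE ?powR_gt0// ler_ln// posrE ?F0//.
  by rewrite mulr_gt0 ?powR_gt0.
move=> x y t x0 y0 t01; have [xy|/ltW yx] := leP x y; first exact: H.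
have := H y x (1 - t) y0 yx; rewrite opprB addrCA subrr addr0 => H'.
by rewrite [X in F X]addrC [leRHS]mulrC; apply: H'; lra.
Qed.

End logconvex.

(** * Second differences of ln f(.; q), uniformly in q *)

Section multiplication_logconvex.
Context {R : realType}.

(** Points x - h may approach 0, where no compactness is available. Shifting to y = x + 1 only
    lowers the second difference and puts y - h and y + h into [1, 2K + 1]. *)
Lemma logdiff_lower_bound (f : R -> R -> R) (K : R) :
  (forall x q : R, dom R (x, q) -> 0 < f x q) ->
  {within dom R, continuous (fun p : R * R => f p.1 p.2)} ->
  (forall x q : R, dom R (x, q) -> f (x + 1) q = qnumber q x * f x q) ->
  C_in_x 2 f ->
  exists2 C, 0 <= C & forall q x h, 0 <= q <= 1 -> 0 < h < x -> x <= K ->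
    - (C * h ^+ 2) <= logdiff (f ^~ q) x h.
Proof.
move=> f_gt0 f_cont f_shift [df cdf].
have domE (x q : R) : 0 < x -> 0 <= q <= 1 -> dom R (x, q).
  by move=> x0 q01; split; rewrite /= in_itv ?andbT.
have [B0 B00 fB0] := dom_bounded (2 * K + 1) ltr01 f_cont.
have [c c0 fc] : exists2 c, 0 < c & forall x q,
    1 <= x <= 2 * K + 1 -> 0 <= q <= 1 -> c <= f x q.
  have f0 (p : R * R) : dom R p -> 0 < f p.1 p.2 by case: p => x q; exact: f_gt0.
  exact: (dom_bounded_below (2 * K + 1) ltr01 f_cont f0).
have [B1 B10 fB1] := dom_bounded (2 * K + 1) ltr01 (cdf 1%N isT).
have [B2 B20 fB2] := dom_bounded (2 * K + 1) ltr01 (cdf 2%N isT).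
(* The numerator times h^2 will bound f(y)^2 - f(y + h) f(y - h), and c^2 comes from
   [logdiff_ge]. *)
exists ((2 * B0 * B2 + B1 ^+ 2) / c ^+ 2).
  by rewrite divr_ge0 ?sqr_ge0// addr_ge0 ?sqr_ge0// !mulr_ge0.
move=> q x h q01 /andP[h0 hx] xK.
have d0 z : 1 <= z <= 2 * K + 1 -> derivable (f ^~ q) z 1.
  by move=> z1; apply: (df 0%N z q isT); apply: domE => //; lra.
have d1 z : 1 <= z <= 2 * K + 1 -> derivable (derive1 (f ^~ q)) z 1.
  by move=> z1; apply: (df 1%N z q isT); apply: domE => //; lra.
apply: (@le_trans _ _ (logdiff (f ^~ q) (x + 1) h)); last first.
  apply: (logdiff_shift q01); last by rewrite h0.
  - by move=> y y0; apply: f_gt0; exact: domE.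
  - by move=> y y0; apply: f_shift; exact: domE.
rewrite mulrAC; set y := x + 1.
have y0 : 0 < f y q by apply: f_gt0; apply: domE => //; rewrite /y; lra.
have fu : `|f (y + h) q - f y q| <= B1 * h.
  have := @bounded_diff R (f ^~ q) 1 (2 * K + 1) y (y + h) B1 d0.
  rewrite [y + h - y]addrAC subrr add0r; apply; rewrite ?/y; try lra.
  by move=> z z1; exact: fB1.
have fd : `|f y q - f (y - h) q| <= B1 * h.
  have := @bounded_diff R (f ^~ q) 1 (2 * K + 1) (y - h) y B1 d0.
  rewrite opprB addrCA subrr addr0; apply; rewrite ?/y; try lra.
  by move=> z z1; exact: fB1.
have fdd : `|f (y + h) q + f (y - h) q - 2 * f y q| <= 2 * B2 * h ^+ 2.
  apply: (@bounded_diff2 R (f ^~ q) 1 (2 * K + 1)) => //; rewrite ?/y; try lra.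
  by move=> z z1; exact: fB2.
apply: logdiff_ge => //.
- by rewrite mulr_ge0 ?sqr_ge0// addr_ge0 ?sqr_ge0// !mulr_ge0.
- by apply: fc => //; rewrite /y; lra.
- by apply: fc => //; rewrite /y; lra.
have fy : `|f y q| <= B0 by apply: (fB0 y q) => //; rewrite /y; lra.
(* Isolates one second difference, of size 2 B2 h^2, and a product of two first differences, each of
   size B1 h. *)
rewrite (_ : _ - _ = - (f y q * (f (y + h) q + f (y - h) q - 2 * f y q)) +
  (f (y + h) q - f y q) * (f y q - f (y - h) q)); last by ring.
rewrite [leRHS]mulrDl; apply: lerD.
  apply: le_trans (ler_norm _) _; rewrite normrN normrM.
  apply: le_trans (ler_pM _ _ fy fdd) _ => //.
  by rewrite le_eqVlt; apply/orP; left; apply/eqP; ring.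
apply: le_trans (ler_norm _) _; rewrite normrM.
apply: le_trans (ler_pM _ _ fu fd) _ => //.
by rewrite le_eqVlt; apply/orP; left; apply/eqP; ring.
Qed.

Lemma multiplication_logdiff_ge0 (f : R -> R -> R) (m : nat) (alpha : R -> R) q x h :
  (forall x q : R, dom R (x, q) -> 0 < f x q) ->
  {within dom R, continuous (fun p : R * R => f p.1 p.2)} ->
  (forall x q : R, dom R (x, q) -> f (x + 1) q = qnumber q x * f x q) ->
  C_in_x 2 f -> (2 <= m)%N ->
  (forall q : R, 0 <= q <= 1 -> 0 < alpha q) ->
  multiplication_formula f m alpha -> 0 <= q <= 1 -> 0 < h < x ->
  0 <= logdiff (f ^~ q) x h.
Proof.
move=> f_gt0 f_cont f_shift f_C2 m2 alpha0 fm.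
have domE (y r : R) : 0 < y -> 0 <= r <= 1 -> dom R (y, r).
  by move=> y0 r01; split; rewrite /= in_itv ?andbT.
have m0 : (0 < m)%N by apply: leq_trans m2.
have m0' : 0 < m%:R :> R by rewrite ltr0n.
have m1' : 2 <= m%:R :> R by rewrite (ler_nat _ 2).
pose K := Num.max x 1.
have K1 : 1 <= K by rewrite le_max lexx orbT.
have xK : x <= K by rewrite le_max lexx.
have [C C0 fC] := logdiff_lower_bound K f_gt0 f_cont f_shift f_C2.
(* m terms of step h/m: one step of the induction divides the constant by m;
  the range x <= K is preserved because K >= 1 *)
have fCn (n : nat) : forall q x h : R, 0 <= q <= 1 -> 0 < h < x -> x <= K ->
    - (C / m%:R ^+ n * h ^+ 2) <= logdiff (f ^~ q) x h.
  elim: n => [|n IH] {}q y k q01 /andP[k0 ky] yK.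
    by rewrite expr0 divr1; apply: fC => //; rewrite k0.
  have /andP[q0 q1] := q01.
  have qm01 : 0 <= q ^+ m <= 1 by rewrite exprn_ge0// exprn_ile1.
  rewrite (@logdiff_mult _ (f ^~ (q ^+ m)) (f ^~ q) (alpha q) (qnumber q m%:R) m)//.
  - rewrite [leLHS](_ : _ = \sum_(0 <= i < m)
        - (C / m%:R ^+ n * (k / m%:R) ^+ 2)); last first.
      rewrite sumr_const_nat subn0 -mulr_natr exprS; field.
      by rewrite !mul1r expf_neq0 ?andbT lt0r_neq0.
    (* The induction hypothesis is used at base q^m, which is why it quantifies over q. *)
    apply: ler_sum_nat => i /andP[_ im]; apply: IH => //.
    + rewrite divr_gt0// ltr_pM2r ?invr_gt0//=.
      by rewrite (lt_le_trans ky)// lerDl.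
    + rewrite ler_pdivrMr//.
      have im' : i%:R <= m%:R - 1 :> R by rewrite lerBrDr natr1 ler_nat.
      nra.
  - exact: alpha0.
  - by rewrite qnumber_gt0// ltr0n.
  - by move=> z z0; apply: f_gt0; exact: domE.
  - by move=> z z0; apply: f_gt0; exact: domE.
  - by move=> z z0; apply: fm; exact: domE.
  - by rewrite k0.
move=> q01 hx; rewrite leNgt; apply/negP => D0.
set D := logdiff _ _ _ in D0.
(* Since m^n > n, this n makes C h^2 / m^n smaller than -D, against the bound [fCn]. *)
pose n := (Num.truncn (C * h ^+ 2 / - D)).+1.
have : C * h ^+ 2 / - D < m%:R ^+ n.
  apply: (lt_trans (truncnS_gt _)).
  by rewrite -natrX ltr_nat ltn_expl.
have mn0 : 0 < m%:R ^+ n :> R by rewrite exprn_gt0.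
rewrite ltr_pdivrMr ?oppr_gt0// -ltr_pdivrMl// mulrA (mulrC _ C) ltrNr.
by rewrite ltNge fCn.
Qed.

Lemma multiplication_logconvex (f : R -> R -> R) (m : nat) (alpha : R -> R) q :
  (forall x q : R, dom R (x, q) -> 0 < f x q) ->
  {within dom R, continuous (fun p : R * R => f p.1 p.2)} ->
  (forall x q : R, dom R (x, q) -> f (x + 1) q = qnumber q x * f x q) ->
  C_in_x 2 f -> (2 <= m)%N ->
  (forall q : R, 0 <= q <= 1 -> 0 < alpha q) ->
  multiplication_formula f m alpha -> 0 <= q <= 1 -> logconvex (f ^~ q).
Proof.
move=> f_gt0 f_cont f_shift f_C2 m2 alpha0 fm q01.
have domE (y r : R) : 0 < y -> 0 <= r <= 1 -> dom R (y, r).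
  by move=> y0 r01; split; rewrite /= in_itv ?andbT.
apply: logdiff_ge0_logconvex => [x x0|x x0|x h hx].
- by apply: f_gt0; exact: domE.
- by apply: (f_C2.1 0%N) => //; exact: domE.
- exact: (multiplication_logdiff_ge0 f_gt0 f_cont f_shift f_C2 m2 alpha0 fm).
Qed.

End multiplication_logconvex.

(** * The multiplication formula from uniqueness *)

Section multiplication.
Context {R : realType}.

Lemma logconvex_cst (c : R) : 0 < c -> logconvex (fun=> c).
Proof.
move=> c0 x y t _ _ _; rewrite -powRD; last by rewrite (gt_eqF c0) implybT.
by rewrite subrK powRr1// ltW.
Qed.

Lemma logconvex_powR (b : R) : 0 < b -> logconvex (fun x => b `^ (x - 1)).
Proof.
move=> b0 x y t _ _ _; rewrite -!powRrM -powRD; last by rewrite (gt_eqF b0) implybT.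
by rewrite le_eqVlt; apply/orP; left; apply/eqP; congr (_ `^ _); ring.
Qed.

Lemma logconvex_prod (I : Type) (r : seq I) (F : I -> R -> R) :
  (forall i x, 0 < x -> 0 < F i x) -> (forall i, logconvex (F i)) ->
  logconvex (fun x => \prod_(i <- r) F i x).
Proof.
move=> F0 cF; elim: r => [|i r IH].
  rewrite (_ : (fun _ => _) = fun=> 1); first exact: logconvex_cst.
  by apply/funext => x; rewrite big_nil.
rewrite (_ : (fun _ => _) = F i \* (fun x => \prod_(j <- r) F j x)).
  apply: logconvexM => //; first exact: F0.
  by move=> x x0; apply: prodr_gt0 => j _; exact: F0.
by apply/funext => x; rewrite big_cons.
Qed.

(** As a function of y = m x, the normalised product [H] is log-convex as a product of log-convex
    factors. A unit shift of y cycles the m factors, giving [y/m]_{q^m}; with [m]_q from the power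
    this is [y]_q. Uniqueness then identifies [H] with f(.; q). *)
Lemma qgamma_multiplication (f : R -> R -> R) (q : R) (m : nat) x :
  (forall q : R, 0 <= q <= 1 -> is_qgamma q (f ^~ q)) ->
  (forall q : R, 0 <= q <= 1 -> logconvex (f ^~ q)) ->
  0 <= q <= 1 -> (0 < m)%N -> 0 < x ->
  \prod_(0 <= i < m) f (x + i%:R / m%:R) (q ^+ m) =
  (\prod_(1 <= i < m) f (i%:R / m%:R) (q ^+ m)) *
    qnumber q m%:R `^ (1 - m%:R * x) * f (m%:R * x) q.
Proof.
move=> Hf cf q01 m0 x0; have /andP[q0 q1] := q01.
have qm01 : 0 <= q ^+ m <= 1 by rewrite exprn_ge0// exprn_ile1.
have m0' : 0 < m%:R :> R by rewrite ltr0n.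
pose g := f ^~ (q ^+ m).
have Hg : is_qgamma (q ^+ m) g by exact: Hf.
have g0 y : 0 < y -> 0 < g y by exact: qgamma_gt0 Hg _.
pose b := qnumber q m%:R.
have b0 : 0 < b by rewrite qnumber_gt0.
pose A := \prod_(1 <= i < m) g (i%:R / m%:R).
have A0 : 0 < A.
  rewrite /A big_add1; apply: prodr_gt0 => i _.
  by apply: g0; rewrite divr_gt0// ltr0n.
pose G i y := g (m%:R^-1 * y + i%:R / m%:R).
have G0 i y : 0 < y -> 0 < G i y.
  by move=> y0; apply: g0; rewrite ltr_wpDr ?divr_ge0// mulr_gt0// invr_gt0.
pose P y := \prod_(0 <= i < m) G i y.
have P0 y : 0 < y -> 0 < P y by move=> y0; apply: prodr_gt0 => i _; exact: G0.
have cP : logconvex P.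
  apply: logconvex_prod => // i; apply: logconvex_comp; last exact: cf.
    by rewrite invr_gt0.
  by rewrite divr_ge0.
pose H := (fun y => b `^ (y - 1)) \* P \* (fun=> A^-1).
have bP0 y : 0 < y -> 0 < ((fun y => b `^ (y - 1)) \* P) y.
  by move=> y0; rewrite /= mulr_gt0 ?powR_gt0 ?P0.
have H0 y : 0 < y -> 0 < H y by move=> y0; rewrite /H/= mulr_gt0 ?bP0 ?invr_gt0.
have cH : logconvex H.
  apply: logconvexM => //; first by move=> *; rewrite invr_gt0.
    by apply: logconvexM => //; [move=> *; rewrite powR_gt0|exact: logconvex_powR].
  by apply: logconvex_cst; rewrite invr_gt0.
have GS i y : G i (y + 1) = G i.+1 y.
  by rewrite /G -natr1; congr g; ring.
have PS y : 0 < y -> P (y + 1) = qnumber (q ^+ m) (m%:R^-1 * y) * P y.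
  move=> y0; have ym0 : 0 < m%:R^-1 * y by rewrite mulr_gt0// invr_gt0.
  have Gm : G m y = qnumber (q ^+ m) (m%:R^-1 * y) * G 0%N y.
    by rewrite /G divff ?gt_eqF// mul0r addr0 (qgammaS Hg).
  have : G 0%N y * P (y + 1) = P y * G m y.
    rewrite /P -big_nat_recr//= big_nat_recl//; congr (_ * _).
    by apply: eq_bigr => i _; rewrite GS.
  by rewrite Gm => e; apply: (mulfI (lt0r_neq0 (G0 0%N y y0))); rewrite e; ring.
have HH : is_qgamma q H.
  apply: logconvex_is_qgamma => //.
    rewrite /H/= subrr powRr0 mul1r (_ : P 1 = A) ?divff ?gt_eqF//.
    (* At y = 1 the indices run from 1 to m, and the extra factor i = m is g(1) = 1. *)
    transitivity (\prod_(1 <= i < m.+1) g (i%:R / m%:R)).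
      rewrite big_add1; apply: eq_bigr => i _; congr g.
      by rewrite mulr1 -natr1; ring.
    by rewrite big_nat_recr//= divff ?gt_eqF// (qgamma1 Hg) mulr1.
  move=> y y0; have ym0 : 0 < m%:R^-1 * y by rewrite mulr_gt0// invr_gt0.
  rewrite /H/= PS// addrK -[X in qnumber q X](mulVKf (lt0r_neq0 m0')) qnumber_mull//.
  rewrite -/b powRB; last by rewrite (gt_eqF b0) implybT.
  by rewrite powRr1 ?(ltW b0)//; field; rewrite !gt_eqF.
have mx0 : 0 < m%:R * x by rewrite mulr_gt0.
have <- := qgamma_unique q01 HH (Hf _ q01) mx0.
have bb : b `^ (1 - m%:R * x) * b `^ (m%:R * x - 1) = 1.
  by rewrite -powRD ?(gt_eqF b0) ?implybT// addrA subrK subrr powRr0.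
rewrite /H/= -/g -/b -/A mulrA mulrA -(mulrA A) bb mulr1 mulrAC divff ?gt_eqF// mul1r.
by apply: eq_bigr => i _; rewrite /G mulKf// gt_eqF.
Qed.

End multiplication.

(** * The case q < 1 *)

Section qpochhammer.
Context {R : realType}.
Implicit Types (a q x : R) (F : R -> R).

Lemma qpochhammer_cvg a q : 0 <= a <= 1 -> 0 <= q < 1 ->
  (fun n => \prod_(0 <= k < n) (1 - a * q ^+ k)) @ \oo --> qpochhammer a q.
Proof.
move=> /andP[a0 a1] /andP[q0 q1].
have f01 k : 0 <= 1 - a * q ^+ k <= 1.
  rewrite subr_ge0 gerBl mulr_ge0 ?exprn_ge0// andbT.
  by rewrite mulr_ile1 ?exprn_ge0// exprn_ile1// ltW.
apply: nonincreasing_is_cvgn.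
  apply/nonincreasing_seqP => n; rewrite big_nat_recr//= ler_piMr//.
    by apply: prodr_ge0 => k _; have /andP[] := f01 k.
  by have /andP[] := f01 n.
exists 0 => _ [n _ <-]; apply: prodr_ge0 => k _; by have /andP[] := f01 k.
Qed.

(** The n-th partial product is at least exp(- a / (1 - a) [n]_q), by induction with [n + 1]_q =
    [n]_q + q^n; as [n]_q <= 1 / (1 - q), this stays away from 0. *)
Lemma qpochhammer_gt0 a q : 0 <= a < 1 -> 0 <= q < 1 -> 0 < qpochhammer a q.
Proof.
move=> /andP[a0 a1] /andP[q0 q1].
have a1' : 0 < 1 - a by rewrite subr_gt0.
have q1' : 0 < 1 - q by rewrite subr_gt0.
apply: (@lt_le_trans _ _ (expR (- (a / (1 - a) / (1 - q))))); first exact: expR_gt0.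
have cv : (fun n => \prod_(0 <= k < n) (1 - a * q ^+ k)) @ \oo --> qpochhammer a q.
  by apply: qpochhammer_cvg; rewrite ?a0 ?q0// ltW.
rewrite /qpochhammer; apply: limr_ge; first by apply/cvg_ex; exists (qpochhammer a q).
apply: nearW => n.
have q01 : 0 <= q <= 1 by rewrite q0 ltW.
apply: (@le_trans _ _ (expR (- (a / (1 - a) * qnumber q n%:R)))).
  rewrite ler_expR lerN2 ler_wpM2l ?divr_ge0 ?(ltW a1')//.
  rewrite /qnumber (lt_eqF q1) powR_mulrn// ler_piMl ?invr_ge0 ?(ltW q1')//.
  by rewrite gerBl exprn_ge0.
elim: n => [|n IH].
  by rewrite big_geq// /qnumber (lt_eqF q1) powRr0 subrr mul0r mulr0 oppr0 expR0.
rewrite big_nat_recr//= qnumberS// mulrDr opprD.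
have qn0 : 0 <= q ^+ n by rewrite exprn_ge0.
have qn1 : q ^+ n <= 1 by rewrite exprn_ile1// ltW.
have z1 : a * q ^+ n <= a by rewrite ler_piMr.
have y0 : 0 < 1 - a * q ^+ n by lra.
(* (1 - z)^-1 = 1 + z / (1 - z) <= exp (z / (1 - a)) for z = a q^n <= a *)
rewrite expRD ler_pM ?expR_ge0// expRN invf_ple ?posrE ?expR_gt0//.
apply: le_trans (expR_ge1Dx _).
have -> : (1 - a * q ^+ n)^-1 = 1 + a * q ^+ n / (1 - a * q ^+ n).
  by rewrite -[X in _ = X + _](divff (lt0r_neq0 y0)) -mulrDl subrK mul1r.
rewrite lerD2l [leRHS]mulrAC ler_wpM2l ?mulr_ge0// lef_pV2 ?posrE//; lra.
Qed.

Lemma qpochhammerS a q : 0 <= a <= 1 -> 0 <= q < 1 ->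
  qpochhammer a q = (1 - a) * qpochhammer (a * q) q.
Proof.
move=> /andP[a0 a1] q01; have /andP[q0 q1] := q01.
apply: (@cvg_unique _ _ ((fun n => \prod_(0 <= k < n.+1) (1 - a * q ^+ k)) @ \oo)) => //.
  have := @qpochhammer_cvg a q; rewrite -cvg_shiftS a0 a1; exact.
have -> : (fun n => \prod_(0 <= k < n.+1) (1 - a * q ^+ k)) =
    (fun n => (1 - a) * \prod_(0 <= k < n) (1 - a * q * q ^+ k)).
  apply/funext => n; rewrite big_nat_recl// expr0 mulr1; congr (_ * _).
  by apply: eq_bigr => k _; rewrite exprS mulrA.
apply: cvgM; first exact: cvg_cst.
by apply: qpochhammer_cvg; rewrite // mulr_ge0//= mulr_ile1// ltW.
Qed.

Lemma qGammaS q x : 0 < q < 1 -> 0 < x ->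
  qGamma q (x + 1) = qnumber q x * qGamma q x.
Proof.
move=> /andP[q0 q1] x0; rewrite /qGamma /qnumber (gt_eqF q0) (lt_eqF q1).
have q01 : 0 <= q < 1 by rewrite ltW.
have qx : 0 <= q `^ x < 1 by rewrite powR_ge0 powR_lt1.
have /andP[qx0 qx1] := qx.
have qxq : q `^ (x + 1) = q `^ x * q.
  by rewrite powRD ?powRr1 ?(ltW q0)// (gt_eqF q0) implybT.
rewrite qxq (@qpochhammerS (q `^ x))//; last by rewrite powR_ge0 ltW.
have P0 : 0 < qpochhammer (q `^ x * q) q.
  by apply: qpochhammer_gt0 => //; rewrite mulr_ge0 ?(ltW q0)//= mulr_ilt1// ltW.
have -> : (1 - q) `^ (1 - x) = (1 - q) `^ (1 - (x + 1)) * (1 - q).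
  rewrite -[X in _ * X]powRr1 ?subr_ge0 ?(ltW q1)// -powRD.
    by congr (_ `^ _); ring.
  by rewrite (_ : 1 - q == 0 = false) ?implybT// gt_eqF// subr_gt0.
by field; rewrite !subr_eq0 !(gt_eqF P0) (gt_eqF qx1) (gt_eqF q1).
Qed.

(** Iterates the shift equation, with (1 - q) [x + k]_q = 1 - q^x q^k; the finite product is a
    truncation of (q^x; q)_oo. *)
Lemma qgamma_prod q F x (n : nat) : 0 <= q < 1 -> is_qgamma q F -> 0 < x ->
  F (x + n%:R) * (1 - q) ^+ n = (\prod_(0 <= k < n) (1 - q `^ x * q ^+ k)) * F x.
Proof.
move=> /andP[q0 q1] HF x0; elim: n => [|n IH].
  by rewrite big_geq// addr0 expr0 mulr1 mul1r.
have xn0 : 0 < x + n%:R by rewrite ltr_wpDr.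
rewrite -natr1 addrA (qgammaS HF)// big_nat_recr//= [RHS]mulrAC -IH exprS.
rewrite /qnumber (lt_eqF q1) -powR_mulrn// -powRD; last first.
  by rewrite (gt_eqF xn0).
by field; rewrite subr_eq0 gt_eqF.
Qed.

(** For q = 0 the constant 1 also satisfies [is_qgamma]. For 0 < q < 1 it is enough to take x <= 1:
    there the truncations [v] of (q; q)_oo are squeezed between multiples of the truncations [u] of
    (q^x; q)_oo. *)
Lemma qgammaE q F x : 0 <= q < 1 -> is_qgamma q F -> 0 < x -> F x = qGamma q x.
Proof.
move=> /andP[]; rewrite le_eqVlt => /predU1P[<- _ HF x0|q0 q1 HF].
  rewrite /qGamma eqxx; apply: (@qgamma_unique _ 0 F (fun=> 1)) => //.
    by rewrite lexx ler01.
  have n0 (y : R) : 0 < y -> qnumber 0 y = 1.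
    move=> y0; rewrite /qnumber eq_sym oner_eq0 powR0 ?gt_eqF//.
    by rewrite subr0 divr1.
  by split => // [y y0|y s y0 _]; rewrite n0// ?powR1 mulr1.
have q01 : 0 <= q < 1 by rewrite ltW.
have q01' : 0 <= q <= 1 by rewrite !ltW.
have q1' : 0 < 1 - q by rewrite subr_gt0.
apply: (@eq_qnumber_shift _ q F (qGamma q)) => // {x} [x x0|x x0|x /andP[x0 x1]].
- exact: qgammaS HF _ x0.
- by apply: qGammaS; rewrite ?q0.
have Fx0 := qgamma_gt0 HF x0.
rewrite /qGamma (gt_eqF q0) (lt_eqF q1).
(* The limit of [n]_q^(1 - x), and the inverse of the power of 1 - q in the formula for Gamma_q. *)
pose c := ((1 - q)^-1) `^ (1 - x).
have cE : (1 - q) `^ (1 - x) = c^-1.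
  by rewrite /c -(powR_inv1 (ltW q1')) -powRrM mulN1r powRN invrK.
have c0 : 0 < c by rewrite powR_gt0// invr_gt0.
pose u n := \prod_(0 <= k < n) (1 - q `^ x * q ^+ k).
pose v n := \prod_(0 <= k < n) (1 - q * q ^+ k).
have qx1 : 0 <= q `^ x < 1 by rewrite powR_ge0 powR_lt1.
have U0 := qpochhammer_gt0 qx1 q01.
have cu : u @ \oo --> qpochhammer (q `^ x) q.
  by apply: qpochhammer_cvg => //; case/andP: qx1 => -> /ltW.
have cv : v @ \oo --> qpochhammer q q by exact: qpochhammer_cvg.
have uE n : u n * F x = F (x + n%:R) * (1 - q) ^+ n by rewrite qgamma_prod.
have vE n : v n = F (n.+1%:R) * (1 - q) ^+ n.
  rewrite -nat1r qgamma_prod// (qgamma1 HF) mulr1 powRr1//; exact: ltW.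
have x10 : 0 <= 1 - x by rewrite subr_ge0.
have qn n : qnumber q n%:R = (1 - q ^+ n) / (1 - q).
  by rewrite /qnumber (lt_eqF q1) powR_mulrn// ltW.
(* From F(n + 1) <= [x + n]_q^(1 - x) F(x + n) and [x + n]_q <= 1 / (1 - q). *)
have vu n : (0 < n)%N -> v n <= u n * F x * c.
  move=> n0; rewrite uE vE mulrAC ler_wpM2r ?exprn_ge0 ?(ltW q1')//.
  have xn0 : 0 < x + n%:R by rewrite ltr_wpDr.
  have := qgammaD_le HF xn0 (_ : 0 <= 1 - x <= 1).
  rewrite (_ : x + n%:R + (1 - x) = n.+1%:R); last by rewrite -natr1; ring.
  move=> /(_ _)/le_trans -> //; first by rewrite x10 gerBl ltW.
  rewrite mulrC ler_wpM2l ?(ltW (qgamma_gt0 HF xn0))//.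
  apply: ge0_ler_powR => //; rewrite ?nnegrE ?invr_ge0 ?(ltW q1')//.
    exact/ltW/qnumber_gt0.
  rewrite /qnumber (lt_eqF q1) ler_piMl ?invr_ge0 ?(ltW q1')//.
  by rewrite gerBl powR_ge0.
(* From F(n + x) <= [n]_q^x F(n), and [n]_q^(1 - x) = c (1 - q^n)^(1 - x) >= c (1 - q^n). *)
have uv n : (0 < n)%N -> u n * F x * c * (1 - q ^+ n) <= v n.
  move=> n0; have n0' : 0 < n%:R :> R by rewrite ltr0n.
  rewrite uE vE -natr1 (qgammaS HF)// -!mulrA mulrCA.
  rewrite [leRHS]mulrA [leRHS]mulrC ler_wpM2l ?exprn_ge0 ?(ltW q1')//.
  have Qn0 := qnumber_gt0 q01' n0'; have Fn0 := qgamma_gt0 HF n0'.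
  have qn0 : 0 <= 1 - q ^+ n by rewrite subr_ge0 exprn_ile1 ?ltW.
  apply: (@le_trans _ _ (F (x + n%:R) * qnumber q n%:R `^ (1 - x))).
    rewrite ler_wpM2l ?(ltW (qgamma_gt0 HF _)) ?ltr_wpDr//.
    rewrite qn powRM ?invr_ge0 ?(ltW q1')// mulrC ler_wpM2r ?(ltW c0)//.
    apply: ger1_powR; last by rewrite gerBl ltW.
    by rewrite gerBl exprn_ge0 ?(ltW q0)// andbT subr_gt0 exprn_ilt1 ?ltW// -lt0n.
  have := qgammaD_le HF n0' (_ : 0 <= x <= 1).
  rewrite (addrC n%:R) => /(_ _)/(ler_wpM2r (powR_ge0 (qnumber q n%:R) (1 - x))).
  move=> /(_ _)/le_trans -> //; first by rewrite ltW.
  rewrite mulrAC -powRD; last by rewrite (gt_eqF Qn0) implybT.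
  by rewrite (_ : x + (1 - x) = 1) ?powRr1 ?(ltW Qn0)//; ring.
have VU : qpochhammer q q = qpochhammer (q `^ x) q * F x * c.
  have cuFc : (fun n => u n * F x * c) @ \oo --> qpochhammer (q `^ x) q * F x * c.
    by apply: cvgMl; apply: cvgMl.
  have cq : (fun n => u n * F x * c * (1 - q ^+ n)) @ \oo -->
      qpochhammer (q `^ x) q * F x * c.
    rewrite -[X in _ --> X]mulr1; apply: cvgM => //.
    rewrite -[X in _ --> X]subr0; apply: cvgB; first exact: cvg_cst.
    by apply: cvg_expr; rewrite ger0_norm ?(ltW q0).
  apply: (@cvg_unique _ _ (v @ \oo)) => //.
  apply: squeeze_cvgr cq cuFc.
  by exists 1%N => // n /= n0; rewrite uv//= vu.
by rewrite VU cE; field; rewrite !gt_eqF.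
Qed.

End qpochhammer.

(** * Euler's integral *)

Section gamma_integral.
Context {R : realType}.
Notation mu := (@lebesgue_measure R).
Implicit Types (x y s t a b : R) (n : nat).

(** The exponent is x, not x - 1, so [gammae x] below is Gamma(x + 1), as an extended real until
    finiteness is known. *)
Definition gammaf x t := t `^ x * expR (- t).

Definition gammae x := (\int[mu]_(t in `]0%R, +oo[) (gammaf x t)%:E)%E.

Lemma gammaf_ge0 x t : 0 <= gammaf x t.
Proof. by rewrite mulr_ge0 ?powR_ge0 ?expR_ge0. Qed.

Lemma gammae_ge0 x : (0 <= gammae x)%E.
Proof. by apply: integral_ge0 => t _; rewrite lee_fin gammaf_ge0. Qed.

Lemma measurable_gammaf x (D : set R) : measurable D ->
  measurable_fun D (EFin \o gammaf x).
Proof.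
move=> mD; apply/measurable_EFinP; apply: measurable_funTS.
apply: measurable_funM; first exact: measurable_powR.
by apply: measurableT_comp => //; exact: measurableT_comp.
Qed.

Lemma derivable_gammaf x t : 0 < t -> derivable (gammaf x) t 1.
Proof.
move=> t0; apply: derivableM; last by apply: ex_derive.
by apply: derivable_powR; rewrite in_itv/= t0.
Qed.

Lemma gammaf_integrable x a b : 0 < a -> mu.-integrable `[a, b] (EFin \o gammaf x).
Proof.
move=> a0; apply: continuous_compact_integrable; first exact: segment_compact.
apply: derivable_within_continuous => t; rewrite in_itv/= => /andP[at_ _].
by apply: derivable_gammaf; rewrite (lt_le_trans a0).
Qed.

Lemma derivable_LRcontinuous (F : R -> R) a b : 0 < a -> a < b ->
  (forall t, 0 < t -> derivable F t 1) -> derivable_oo_LRcontinuous F a b.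
Proof.
move=> a0 ab dF.
have cF t : 0 < t -> {for t, continuous F}.
  by move=> t0; apply/differentiable_continuous/derivable1_diffP/dF.
split.
- by move=> t; rewrite in_itv/= => /andP[at_ _]; apply: dF; exact: lt_trans at_.
- by apply: cvg_at_right_filter; exact: cF.
- by apply: cvg_at_left_filter; apply: cF; exact: lt_trans ab.
Qed.

Lemma gammaf_by_parts x a b : 0 < a -> a < b ->
  \int[mu]_(t in `[a, b]) gammaf x t =
  gammaf x a - gammaf x b + x * \int[mu]_(t in `[a, b]) gammaf (x - 1) t.
Proof.
move=> a0 ab.
have E t : 0 < t -> is_derive t 1 (fun t => expR (- t)) (- expR (- t)).
  move=> t0; apply: is_derive_eq; rewrite ?scaleN1r ?scalerN1 //.
  by rewrite mulrN1.
have P t : 0 < t -> is_derive t 1 (@powR R ^~ x) (x * t `^ (x - 1)).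
  by move=> t0; exact: (@is_derive1_powR R x t t0).
rewrite (@Rintegration_by_parts _ (@powR R ^~ x) (fun t => - expR (- t))
  (fun t => x * t `^ (x - 1)) (fun t => expR (- t)))//.
- have -> : \int[mu]_(t in `[a, b]) (x * t `^ (x - 1) * - expR (- t)) =
      \int[mu]_(t in `[a, b]) (- x * gammaf (x - 1) t).
    by apply: eq_Rintegral => t _; rewrite /gammaf; ring.
  rewrite RintegralZl//; last exact: gammaf_integrable.
  by rewrite /gammaf; ring.
- apply: derivable_within_continuous => t; rewrite in_itv/= => /andP[at_ _].
  apply: derivableM => //.
  by apply: derivable_powR; rewrite in_itv/= (lt_le_trans a0).
- by apply: derivable_LRcontinuous => // t t0; have [] := P t t0.
- move=> t; rewrite in_itv/= => /andP[at_ _]; rewrite derive1E.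
  by have [_ ->] := P t (lt_trans a0 at_).
- apply: derivable_within_continuous => t; rewrite in_itv/= => /andP[at_ _].
  by have [] := E t (lt_le_trans a0 at_).
- exact: derivable_LRcontinuous.
- move=> t; rewrite in_itv/= => /andP[at_ _]; rewrite derive1E.
  have [d e] := E t (lt_trans a0 at_).
  by rewrite deriveN// e opprK.
Qed.

(** Endpoints of compact intervals exhausting (0, +oo); the right one is n + 2 so that the interval
    is nondegenerate already at n = 0. *)
Let left_ n : R := n.+1%:R^-1.
Let right_ n : R := n.+2%:R.

Lemma gammae_cvg x :
  (fun n => (\int[mu]_(t in `[left_ n, right_ n]) gammaf x t)%:E) @ \oo --> gammae x.
Proof.
have l0 n : 0 < left_ n by rewrite invr_gt0.
have -> : gammae x =
    (\int[mu]_(t in \bigcup_n `[left_ n, right_ n]%classic) (gammaf x t)%:E)%E.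
  rewrite /gammae; congr (integral _ _ _); apply/seteqP; split.
    move=> t/=; rewrite in_itv/= andbT => t0.
    exists (Num.truncn t + Num.truncn t^-1)%N => //=; rewrite in_itv/=; apply/andP; split.
      rewrite /left_ invf_ple ?posrE// ltW// (lt_le_trans (truncnS_gt _))//.
      by rewrite ler_nat ltnS leq_addl.
    rewrite /right_ ltW// (lt_le_trans (truncnS_gt _))//.
    by rewrite ler_nat ltnW// !ltnS leq_addr.
  move=> t [n _] /=; rewrite !in_itv/= andbT => /andP[lt_ _].
  exact: lt_le_trans lt_.
have -> : (fun n => (\int[mu]_(t in `[left_ n, right_ n]) gammaf x t)%:E) =
    (fun n => \int[mu]_(t in `[left_ n, right_ n]) (gammaf x t)%:E)%E.
  apply/funext => n; rewrite /Rintegral fineK//.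
  by apply: integrable_fin_num => //; exact: gammaf_integrable.
apply: ge0_nondecreasing_set_cvg_integral => //=.
- apply/nondecreasing_seqP => n; rewrite subsetEset => t/=; rewrite !in_itv/=.
  move=> /andP[lt_ tr]; apply/andP; split.
    by apply: le_trans lt_; rewrite lef_pV2 ?posrE// ler_nat.
  by apply: (le_trans tr); rewrite ler_nat.
- by move=> n; exact: measurable_gammaf.
- by move=> n t _; rewrite lee_fin gammaf_ge0.
Qed.

(** For a natural N >= x, e^r >= r^(N + 1) / (N + 1)! bounds the value at r by (N + 1)! / r. *)
Lemma gammaf_right x : (fun n => gammaf x (right_ n)) @ \oo --> 0.
Proof.
have [N xN] : exists N : nat, x <= N%:R.
  by exists (Num.truncn x).+1; exact/ltW/truncnS_gt.
have cz : (fun n => N.+1`!%:R * @harmonic R n) @ \oo --> (0 : R).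
  by rewrite -(mulr0 (N.+1`!%:R)); apply: cvgM; [exact: cvg_cst|exact: cvg_harmonic].
apply: (squeeze_cvgr _ (cvg_cst 0) cz).
apply: nearW => n; rewrite gammaf_ge0/=.
have r0 : 0 < right_ n by rewrite ltr0n.
have r1 : 1 <= right_ n by rewrite ler1n.
apply: (@le_trans _ _ (right_ n ^+ N * expR (- right_ n))).
  by rewrite ler_wpM2r ?expR_ge0// -powR_mulrn ?(ltW r0)// ler_powR.
rewrite expRN ler_pdivrMr ?expR_gt0//.
apply: (@le_trans _ _ (N.+1`!%:R * (right_ n)^-1 * (right_ n ^+ N.+1 / N.+1`!%:R))).
  rewrite le_eqVlt; apply/orP; left; apply/eqP; rewrite exprS; field.
  by rewrite gt_eqF//= pnatr_eq0 -lt0n fact_gt0.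
apply: ler_pM.
- by rewrite mulr_ge0 ?invr_ge0 ?(ltW r0).
- by rewrite mulr_ge0 ?invr_ge0 ?exprn_ge0 ?(ltW r0).
- by rewrite ler_wpM2l// /harmonic/= lef_pV2 ?posrE// ler_nat.
- by apply: le_trans (expR_ge1Dxn N (ltW r0)); rewrite lerDr.
Qed.

Lemma gammaf_left x : 0 < x -> (fun n => gammaf x (left_ n)) @ \oo --> 0.
Proof.
move=> x0.
have cl : (fun n => left_ n `^ x) @ \oo --> (0 : R).
  have /cvg_at_rightP := powR_cvg0 x0; apply.
  by split; [move=> n; rewrite invr_gt0|exact: cvg_harmonic].
apply: (squeeze_cvgr _ (cvg_cst 0) cl).
apply: nearW => n; rewrite gammaf_ge0/= ler_piMr ?powR_ge0//.
by rewrite -expR0 ler_expR oppr_le0 invr_ge0.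
Qed.

Lemma gammae0 : gammae 0 = 1%E.
Proof.
apply: (cvg_unique _ (@gammae_cvg 0)) => /=; first exact: ereal_hausdorff.
apply/fine_cvgP; split; first exact: nearW.
have -> : fine \o (fun n => (\int[mu]_(t in `[left_ n, right_ n]) gammaf 0 t)%:E) =
    (fun n => expR (- left_ n) - gammaf 0 (right_ n)).
  apply/funext => n /=; rewrite gammaf_by_parts ?invr_gt0//.
    by rewrite mul0r addr0 {1}/gammaf powRr0 mul1r.
  rewrite (@le_lt_trans _ _ 1)// ?invf_le1// ?ler1n//.
  by rewrite ltr1n.
rewrite -[X in _ --> X]subr0; apply: cvgB; last exact: gammaf_right.
rewrite -[X in _ --> X]expR0 -oppr0.
apply: (@cvg_comp _ _ _ (fun n => - left_ n) (@expR R)); last exact: continuous_expR.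
by apply: cvgN; exact: cvg_harmonic.
Qed.

(** Both boundary terms of the integration by parts vanish in the limit. The extended-real form
    presupposes no finiteness, so it can serve to prove it. *)
Lemma gammaeS x : 0 < x -> gammae x = (x%:E * gammae (x - 1))%E.
Proof.
move=> x0; apply: (cvg_unique _ (@gammae_cvg x)) => /=; first exact: ereal_hausdorff.
have -> : (fun n => (\int[mu]_(t in `[left_ n, right_ n]) gammaf x t)%:E) =
    (fun n => ((gammaf x (left_ n) - gammaf x (right_ n))%:E +
      x%:E * (\int[mu]_(t in `[left_ n, right_ n]) gammaf (x - 1) t)%:E)%E).
  apply/funext => n; rewrite gammaf_by_parts ?invr_gt0//.
  rewrite (@le_lt_trans _ _ 1)// ?invf_le1// ?ler1n//.
  by rewrite ltr1n.
rewrite -[X in _ --> X]add0e; apply: cvgeD => //.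
- apply/fine_cvgP; split; first exact: nearW.
  rewrite -[X in _ --> X]subr0; apply: cvgB; last exact: gammaf_right.
  exact: gammaf_left.
- by apply: cvgeZl => //; exact: gammae_cvg.
Qed.

(** Natural exponents follow by induction, real y >= 0 from t^y <= 1 + t^N, and x > -1 from the
    functional equation at x + 1 > 0. *)
Lemma gammae_fin x : -1 < x -> gammae x \is a fin_num.
Proof.
have fin_nat n : gammae n%:R \is a fin_num.
  elim: n => [|n IH]; first by rewrite gammae0.
  by rewrite gammaeS// fin_numM//= -natr1 addrK.
have fin_ge0 y : 0 <= y -> gammae y \is a fin_num.
  move=> y0; rewrite ge0_fin_numE ?gammae_ge0//.
  have [N yN] : exists N : nat, y <= N%:R.
    by exists (Num.truncn y).+1; exact/ltW/truncnS_gt.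
  apply: (@le_lt_trans _ _ (gammae 0 + gammae N%:R)%E); last first.
    by rewrite gammae0 lte_add_pinfty ?ltry// -ge0_fin_numE ?gammae_ge0//.
  rewrite -ge0_integralD//=; last 4 first.
  - by move=> t _; rewrite lee_fin gammaf_ge0.
  - exact: measurable_gammaf.
  - by move=> t _; rewrite lee_fin gammaf_ge0.
  - exact: measurable_gammaf.
  apply: ge0_le_integral => //.
  - by move=> t _; rewrite lee_fin gammaf_ge0.
  - exact: measurable_gammaf.
  - by apply: emeasurable_funD; exact: measurable_gammaf.
  move=> t; rewrite /= in_itv/= andbT => t0; rewrite -EFinD lee_fin /gammaf -mulrDl.
  rewrite ler_wpM2r ?expR_ge0// powRr0.
  have [t1|/ltW t1] := leP t 1.
    rewrite (@le_trans _ _ 1)// ?lerDl ?powR_ge0//.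
    by rewrite -(powRr0 t) ger_powR// t0.
  by rewrite (@le_trans _ _ (t `^ N%:R))// ?lerDr// ler_powR.
move=> x1; have x10 : 0 < x + 1 by lra.
have := gammaeS x10; rewrite addrK => e.
have : gammae (x + 1) \is a fin_num by rewrite fin_ge0// ltW.
rewrite e; have := gammae_ge0 x; case: (gammae x) => [r||]//= _.
by rewrite gt0_muley.
Qed.

Lemma gammaf_integrable0y x : -1 < x ->
  mu.-integrable `]0, +oo[ (EFin \o gammaf x).
Proof.
move=> x1; apply/integrableP; split; first exact: measurable_gammaf.
under eq_integral do rewrite /= ger0_norm ?gammaf_ge0//.
have := gammae_fin x1; rewrite ge0_fin_numE//; exact: gammae_ge0.
Qed.

Lemma GammaE x : Gamma x = fine (gammae (x - 1)).
Proof. by []. Qed.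

Lemma Gamma1 : Gamma (1 : R) = 1.
Proof. by rewrite GammaE subrr gammae0. Qed.

Lemma GammaS x : 0 < x -> Gamma (x + 1) = x * Gamma x.
Proof.
move=> x0; rewrite !GammaE addrK gammaeS// fineM//.
by rewrite gammae_fin//; lra.
Qed.

Lemma powR_le_affine u s : 0 < u -> 0 <= s <= 1 -> u `^ s <= (1 - s) + s * u.
Proof.
move=> u0 /andP[s0 s1]; pose v := ln u.
have -> : u = expR v by rewrite lnK.
(* weighted AM-GM, from e^z >= 1 + z at z = - s v and z = (1 - s) v *)
have e1 : (1 - s) * (1 - s * v) <= (1 - s) * expR (- (s * v)).
  by rewrite ler_wpM2l ?subr_ge0// expR_ge1Dx.
have e2 : s * (1 + (1 - s) * v) <= s * expR ((1 - s) * v).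
  by rewrite ler_wpM2l// expR_ge1Dx.
have -> : expR v `^ s = expR (s * v) by rewrite /powR gt_eqF ?expR_gt0// expRK.
rewrite -[leLHS]mulr1.
have -> : 1 - s + s * expR v =
    expR (s * v) * ((1 - s) * expR (- (s * v)) + s * expR ((1 - s) * v)).
  rewrite mulrDr !(mulrCA (expR _)) -!expRD subrr expR0 mulr1.
  by congr (_ + _ * expR _); ring.
rewrite ler_wpM2l ?expR_ge0//; lra.
Qed.

(** [powR_le_affine] rescaled to u = t / y: the concave function t^s lies below its tangent at y. *)
Lemma powR_le_tangent t y s : 0 < t -> 0 < y -> 0 <= s <= 1 ->
  t `^ s <= (1 - s) * y `^ s + s * y `^ (s - 1) * t.
Proof.
move=> t0 y0 s01; have := powR_le_affine (divr_gt0 t0 y0) s01.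
rewrite powRM ?invr_ge0 ?(ltW t0) ?(ltW y0)//.
have ys0 : 0 < y `^ s by rewrite powR_gt0.
have -> : y^-1 `^ s = (y `^ s)^-1.
  by rewrite -(powR_inv1 (ltW y0)) -powRrM mulN1r powRN.
rewrite ler_pdivrMr// => /le_trans; apply.
rewrite powRB; last by rewrite (gt_eqF y0) implybT.
rewrite powRr1 ?(ltW y0)// mulrDl le_eqVlt; apply/orP; left; apply/eqP.
by field; rewrite gt_eqF.
Qed.

(** Integrating a tangent line takes the place of Hölder's inequality; tangency at y makes Gamma(y)
    and Gamma(y + 1) = y Gamma(y) recombine exactly. *)
Lemma GammaD_le y s : 0 < y -> 0 <= s <= 1 -> Gamma (y + s) <= y `^ s * Gamma y.
Proof.
move=> y0 s01; have /andP[s0 s1] := s01.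
have iy1 : mu.-integrable `]0, +oo[ (EFin \o gammaf (y - 1)).
  by apply: gammaf_integrable0y; lra.
have iy : mu.-integrable `]0, +oo[ (EFin \o gammaf y).
  by apply: gammaf_integrable0y; lra.
(* c + d t is the tangent of t^s at y, integrated against t^(y - 1) e^-t *)
pose c := (1 - s) * y `^ s; pose d := s * y `^ (s - 1).
have -> : y `^ s * Gamma y = c * Gamma y + d * Gamma (y + 1).
  rewrite GammaS// /c /d powRB; last by rewrite (gt_eqF y0) implybT.
  by rewrite powRr1 ?(ltW y0)//; field; rewrite gt_eqF.
have icy : mu.-integrable `]0, +oo[ (EFin \o (fun t => c * gammaf (y - 1) t)).
  by apply: (integrableZl _ c iy1).
have idy : mu.-integrable `]0, +oo[ (EFin \o (fun t => d * gammaf y t)).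
  by apply: (integrableZl _ d iy).
have <- : \int[mu]_(t in `]0, +oo[) (c * gammaf (y - 1) t + d * gammaf y t) =
    c * Gamma y + d * Gamma (y + 1).
  by rewrite RintegralD// !RintegralZl// /Gamma addrK.
apply: le_Rintegral => //.
- by apply: gammaf_integrable0y; lra.
- apply: (@integrableD _ _ _ mu _ _ (EFin \o (fun t => c * gammaf (y - 1) t))
    (EFin \o (fun t => d * gammaf y t))) => //.
move=> t; rewrite /= in_itv/= andbT /gammaf => t0.
have t0' : (t == 0) = false by rewrite gt_eqF.
have -> : t `^ (y + s - 1) = t `^ (y - 1) * t `^ s.
  by rewrite -powRD ?t0' ?implybT//; congr (_ `^ _); ring.
have -> : t `^ y = t `^ (y - 1) * t.
  by rewrite mulrC mulr_powRB1 ?(ltW t0).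
have := powR_le_tangent t0 y0 s01; rewrite -/c -/d => h.
rewrite [leRHS](_ : _ = t `^ (y - 1) * (c + d * t) * expR (- t)); last by ring.
by rewrite ler_wpM2r ?expR_ge0// ler_wpM2l ?powR_ge0.
Qed.

(** Gamma is positive at positive integers, and [GammaD_le] from y to the next integer carries this
    back to y. *)
Lemma Gamma_gt0 y : 0 < y -> 0 < Gamma y.
Proof.
move=> y0.
have Gn n : 0 < Gamma (n.+1%:R : R).
  elim: n => [|n IH]; first by rewrite Gamma1.
  by rewrite -natr1 GammaS// mulr_gt0.
have /andP[tl tr] := truncn_itv (ltW y0).
have := @GammaD_le y ((Num.truncn y).+1%:R - y) y0.
rewrite addrCA subrr addr0 => h.
have := lt_le_trans (Gn _) (h _); rewrite pmulr_rgt0 ?powR_gt0//; apply.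
by rewrite subr_ge0 (ltW tr)/= lerBlDr -natr1 addrC lerD2l.
Qed.

Lemma Gamma_is_qgamma : is_qgamma 1 (@Gamma R).
Proof.
have n1 (x : R) : qnumber 1 x = x by rewrite /qnumber eqxx.
split => [x|| x x0|x s x0 s01]; first exact: Gamma_gt0.
- exact: Gamma1.
- by rewrite n1 GammaS.
- by rewrite n1 GammaD_le.
Qed.

End gamma_integral.

Theorem theorem5p3 (R : realType) (f : R -> R -> R)
  (f_gt0 : forall x q : R, dom R (x, q) -> 0 < f x q)
  (f_cont : {within dom R, continuous (fun p : R * R => f p.1 p.2)})
  (f_shift : forall x q : R, dom R (x, q) ->
     f (x + 1) q = qnumber q x * f x q)
  (f_at1 : forall q : R, 0 <= q <= 1 -> f 1 q = 1)
  (f_C2 : C_in_x 2 f)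
  (f_mult : exists (m : nat) (alpha : R -> R),
     [/\ (2 <= m)%N,
         forall q : R, 0 <= q <= 1 -> 0 < alpha q &
         multiplication_formula f m alpha]) :
  (forall x q : R, dom R (x, q) -> f x q = qGamma q x) /\
  (forall m : nat, (2 <= m)%N ->
     multiplication_formula f m
       (fun q : R => \prod_(1 <= i < m) qGamma (q ^+ m) (i%:R / m%:R))).
Proof.
have [m0 [alpha [m02 alpha0 fm0]]] := f_mult.
have domE (y r : R) : 0 < y -> 0 <= r <= 1 -> dom R (y, r).
  by move=> y0 r01; split; rewrite /= in_itv ?andbT.
have cf (r : R) : 0 <= r <= 1 -> logconvex (f ^~ r).
  exact: (multiplication_logconvex f_gt0 f_cont f_shift f_C2 m02 alpha0 fm0).
have Hf (r : R) : 0 <= r <= 1 -> is_qgamma r (f ^~ r).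
  move=> r01; apply: logconvex_is_qgamma (cf _ r01) => //.
  - by move=> x x0; apply: f_gt0; exact: domE.
  - exact: f_at1.
  - by move=> x x0; apply: f_shift; exact: domE.
have fE (x q : R) : 0 < x -> 0 <= q <= 1 -> f x q = qGamma q x.
  move=> x0 q01; have /andP[q0] := q01; rewrite le_eqVlt => /predU1P[q1|q1].
    rewrite /qGamma q1 oner_eq0 eqxx.
    have i01 : 0 <= (1 : R) <= 1 by rewrite ler01 lexx.
    exact: (qgamma_unique i01 (Hf _ i01) Gamma_is_qgamma x0).
  have q01' : 0 <= q < 1 by rewrite q0.
  exact: (qgammaE q01' (Hf _ q01) x0).
have dom_inv (x q : R) : dom R (x, q) -> 0 < x /\ 0 <= q <= 1.
  by case; rewrite /= !in_itv/= andbT.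
split=> [x q /dom_inv[x0 q01]|m m2 x q /dom_inv[x0 q01]]; first exact: fE.
have mgt0 : (0 < m)%N by exact: leq_trans m2.
(* This m is unrelated to [m0]: log-convexity for every q is now known, and that suffices for any
   m. *)
rewrite (qgamma_multiplication Hf cf q01 mgt0 x0); congr (_ * _ * _).
(* Keeps the bound i >= 1, so that i / m > 0 and [fE] applies. *)
rewrite big_nat [RHS]big_nat; apply: eq_bigr => i /andP[i0 _].
have /andP[q0 q1] := q01; apply: fE; last by rewrite exprn_ge0// exprn_ile1.
by rewrite divr_gt0 ?ltr0n.
Qed.
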